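(* Let $q$ be a prime power and $d\ge1$ a fixed integer. The number of equivalence classes, under dynamical equivalence, of the dynamical systems $(\mathbb{F}_q, x\mapsto ax^d)$ with $a\in\mathbb{F}_q^*$ is equal to $\tau(\gcd(d-1,q-1))$, where $\tau(m)$ denotes the number of positive divisors of $m$.
   Context: Two dynamical systems $(\mathbb{S},f)$ and $(\mathbb{T},g)$ (maps $f:\mathbb{S}\to\mathbb{S}$, $g:\mathbb{T}\to\mathbb{T}$) are dynamically equivalent if there is a bijection $\sigma:\mathbb{S}\to\mathbb{T}$ with $\sigma^{-1}\circ g\circ\sigma=f$. $\mathbb{F}_q^*=\mathbb{F}_q\setminus\{0\}$. For $d=1$, $\gcd(0,q-1)=q-1$. *)

(* Defs.v *)
From mathcomp Require Import all_boot all_algebra all_field.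
From mathcomp Require Import boolp.

Set Implicit Arguments.
Unset Strict Implicit.
Unset Printing Implicit Defensive.

Import GRing.Theory.

Definition dyn_equiv (S T : Type) (f : S -> S) (g : T -> T) : Prop :=
  exists (sigma : S -> T) (sigma_inv : T -> S),
    [/\ cancel sigma sigma_inv, cancel sigma_inv sigma
      & sigma_inv \o g \o sigma =1 f].

Lemma dyn_equiv_refl (S : Type) (f : S -> S) : dyn_equiv f f.
Proof. by exists id, id. Qed.

Lemma dyn_equiv_sym (S T : Type) (f : S -> S) (g : T -> T) :
  dyn_equiv f g -> dyn_equiv g f.
Proof.
move=> [s [s' [sK s'K sgs]]]; exists s', s; split=> // x.
by rewrite /= -sgs /= !s'K.
Qed.

Lemma dyn_equiv_trans (S T U : Type) (f : S -> S) (g : T -> T) (h : U -> U) :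
  dyn_equiv f g -> dyn_equiv g h -> dyn_equiv f h.
Proof.
move=> [s [s' [sK s'K sgs]]] [t [t' [tK t'K tht]]].
exists (t \o s), (s' \o t'); split=> [x|x|x] /=; first by rewrite tK sK.
  by rewrite s'K t'K.
by rewrite -sgs /= -tht.
Qed.

Definition dyn_equivb (S : finType) : rel {ffun S -> S} :=
  fun f g => `[< dyn_equiv f g >].

(* Since [dyn_equivb] is an equivalence relation, the members of
   [equivalence_partition (@dyn_equivb S) D] are exactly its classes on D. *)
Lemma dyn_equivb_equiv (S : finType) : equivalence_rel (@dyn_equivb S).
Proof.
move=> f g h; split; first exact/asboolP/dyn_equiv_refl.
move=> /asboolP fg; apply/asboolP/asboolP => [fh|gh].
  exact: dyn_equiv_trans (dyn_equiv_sym fg) fh.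
exact: dyn_equiv_trans fg gh.
Qed.

Definition dyn_classes (S : finType) (D : {set {ffun S -> S}}) :
    {set {set {ffun S -> S}}} :=
  equivalence_partition (@dyn_equivb S) D.

Definition monomial_systems (F : finFieldType) (d : nat) : {set {ffun F -> F}} :=
  [set [ffun x : F => (a * x ^+ d)%R] | a : F & a != 0%R].

Definition num_divisors (m : nat) : nat := size (divisors m).

(* Main.v *)
Require Import Defs.
From mathcomp Require Import all_boot all_algebra all_field.
From mathcomp Require Import boolp zify.

(* Let n = q - 1, let z generate F^*, and let g = gcd(d - 1, n).  Conjugating by
   x |-> c x^u with u coprime to n shows that x |-> z^i x^d is equivalent to
   x |-> z^(gcd(g, i)) x^d, so that every class is represented by a divisor of g.
   Distinct divisors are separated by the existence of a nonzero fixed point of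
   the iterates: the m-th iterate of x |-> z^i x^d has one exactly when
   gcd(d - 1, n / gcd(n, S_m)) divides i, where S_m = 1 + d + ... + d^(m - 1),
   and by lifting the exponent every divisor of g is such a gcd for some m. *)

Set Implicit Arguments.
Unset Strict Implicit.
Unset Printing Implicit Defensive.

Import GRing.Theory.

(** * Geometric sums and their prime valuations *)

Definition geosum d m := \sum_(i < m) d ^ i.

Lemma geosumS d m : geosum d m.+1 = 1 + d * geosum d m.
Proof.
by rewrite /geosum big_ord_recl big_distrr; congr (_ + _); apply: eq_bigr => i _; rewrite expnS.
Qed.

Lemma geosumD d m k : geosum d (m + k) = geosum d m + d ^ m * geosum d k.
Proof.
elim: m => [|m IHm]; first by rewrite /geosum big_ord0 mul1n.
by rewrite addSn !geosumS IHm mulnDr expnS mulnA addnA.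
Qed.

(** Group the exponents below [m * k] into [k] blocks of length [m]. *)
Lemma geosumM d m k : geosum d (m * k) = geosum d m * geosum (d ^ m) k.
Proof.
elim: k => [|k IHk]; first by rewrite muln0 /geosum !big_ord0 muln0.
by rewrite mulnS geosumD IHk geosumS mulnDr muln1 mulnCA.
Qed.

Lemma expn_geosum d m : d.+1 ^ m = 1 + d * geosum d.+1 m.
Proof. by have := predn_exp d.+1 m; have := expn_gt0 d.+1 m; rewrite /geosum; lia. Qed.

Lemma geosum_gt0 d m : 0 < m -> 0 < geosum d m.
Proof. by case: m => // m _; rewrite geosumS. Qed.

Lemma geosum_mod l d m : l %| d -> geosum d.+1 m = m %[mod l].
Proof.
move=> /dvdnP[x ->]; elim: m => [|m IHm]; first by rewrite /geosum big_ord0.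
rewrite geosumS; set G := geosum _ m in IHm *.
have -> : 1 + (x * l).+1 * G = x * G * l + (G + 1) by lia.
by rewrite modnMDl -modnDml IHm modnDml addn1.
Qed.

(** Modulo [l ^ 2] the expansion of [d.+1 ^ i] stops at [1 + i * d], so the sum is
    [l + 'C(l, 2) * d], and an odd prime [l] divides ['C(l, 2)]. For [l = 2] the sum is [2 + d],
    whence the condition on 4. *)
Lemma geosum_prime_mod l d : prime l -> l %| d -> (l = 2 -> 4 %| d) ->
  geosum d.+1 l = l %[mod l ^ 2].
Proof.
move=> l_pr ld l2; have [l_eq2|l_ne2] := eqVneq l 2.
  by rewrite l_eq2; apply: geosum_mod; apply: l2.
have exp_mod i : d.+1 ^ i = 1 + i * d %[mod l ^ 2].
  elim: i => // i IHi; rewrite expnS -modnMmr IHi modnMmr.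
  have /dvdnP[x dd] : l ^ 2 %| d * d by rewrite dvdn_mul.
  suff -> : d.+1 * (1 + i * d) = i * x * l ^ 2 + (1 + i.+1 * d) by rewrite modnMDl.
  by rewrite -mulnA -dd; lia.
have sum_mod m : geosum d.+1 m = m + 'C(m, 2) * d %[mod l ^ 2].
  elim: m => [|m IHm]; first by rewrite /geosum big_ord0.
  rewrite /geosum big_ord_recr /= -modnDm exp_mod -/(geosum _ _) IHm modnDm.
  by rewrite binS bin1; congr (_ %% _); lia.
have l_gt2 : 2 < l by have := prime_gt1 l_pr; lia.
have /dvdnP[x xE] : l ^ 2 %| 'C(l, 2) * d.
  by rewrite dvdn_mul // prime_dvd_bin.
by rewrite sum_mod xE addnC modnMDl.
Qed.

(** Lifting the exponent: [geosumM] splits off one factor [l] of [m], and the new factor has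
    valuation exactly 1 by [geosum_prime_mod]. Once [l] no longer divides [m], the sum is congruent
    to [m], hence nonzero, modulo [l]. *)
Lemma logn_geosum l d m : prime l -> l %| d -> (l = 2 -> 4 %| d) -> 0 < m ->
  logn l (geosum d.+1 m) = logn l m.
Proof.
move=> l_pr; have [r] := ubnP m; elim: r m d => // r IHr m d mr ld l2 m_gt0.
have [/dvdnP[k mE]|lm] := boolP (l %| m); last first.
  by rewrite !logn_coprime ?prime_coprime // /dvdn geosum_mod.
have k_gt0 : 0 < k by case: k mE m_gt0 => // ->.
have kr : k < r.
  by rewrite -ltnS (leq_trans _ mr) // ltnS mE ltn_Pmulr // prime_gt1.
have l_gt0 := prime_gt0 l_pr.
have d'E := expn_geosum d k; rewrite add1n in d'E.
set d' := d * _ in d'E.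
have ld' : l %| d' by apply: dvdn_mulr.
have l2' : l = 2 -> 4 %| d' by move=> /l2 ?; apply: dvdn_mulr.
have log1 : logn l (geosum d'.+1 l) = 1.
  have Sl : geosum d'.+1 l = l %[mod l ^ 2].
    by apply: geosum_prime_mod.
  have S_gt0 : 0 < geosum d'.+1 l by rewrite geosum_gt0.
  apply/eqP; rewrite eqn_leq -ltnS; apply/andP; split.
    rewrite ltnNge -pfactor_dvdn // /dvdn Sl -/(l ^ 2 %| l).
    by rewrite -[X in _ %| X]expn1 dvdn_Pexp2l // prime_gt1.
  by rewrite -pfactor_dvdn // expn1 /dvdn geosum_mod // modnn.
by rewrite mE geosumM d'E !lognM ?geosum_gt0 // log1 IHr // (logn_prime l l_pr) eqxx.
Qed.

(** Without the condition at 2, the factor split off is only known to be divisible by [l] (for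
    instance 1 + 3 = 4), so only a bound survives. *)
Lemma leq_logn_geosum l d m : prime l -> l %| d -> 0 < m ->
  logn l m <= logn l (geosum d.+1 m).
Proof.
move=> l_pr; have [r] := ubnP m; elim: r m d => // r IHr m d mr ld m_gt0.
have [/dvdnP[k mE]|lm] := boolP (l %| m); last by rewrite lognE (negbTE lm) !andbF.
have k_gt0 : 0 < k by case: k mE m_gt0 => // ->.
have kr : k < r.
  by rewrite -ltnS (leq_trans _ mr) // ltnS mE ltn_Pmulr // prime_gt1.
have l_gt0 := prime_gt0 l_pr.
have d'E := expn_geosum d k; rewrite add1n in d'E.
have ld' : l %| d * geosum d.+1 k by apply: dvdn_mulr.
set d' := d * _ in d'E ld'.
rewrite mE geosumM d'E !lognM ?geosum_gt0 //; apply: leq_add; first exact: IHr.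
rewrite logn_prime // eqxx -pfactor_dvdn ?geosum_gt0 //.
by rewrite expn1 /dvdn geosum_mod // modnn.
Qed.

(* The choice m = n / h works unless d + 1 is 3 mod 4 and h is even: then S_m is
   too divisible by 2, and the odd part of n / h is taken instead. *)
Lemma geosum_realizes_divisor n d h : 0 < n -> h %| gcdn d n ->
  exists m, gcdn d (n %/ gcdn n (geosum d.+1 m)) = h.
Proof.
move=> n_gt0 hg; set g := gcdn d n in hg.
have g_gt0 : 0 < g by rewrite gcdn_gt0 n_gt0 orbT.
have h_gt0 := dvdn_gt0 g_gt0 hg.
have hn : h %| n := dvdn_trans hg (dvdn_gcdr _ _).
have nh_gt0 : 0 < n %/ h by rewrite divn_gt0 // dvdn_leq.
pose bad := ~~ (4 %| d) && (2 %| h).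
pose m := if bad then (n %/ h) %/ 2 ^ logn 2 (n %/ h) else n %/ h.
have m_gt0 : 0 < m.
  rewrite /m; case: ifP => // _.
  by rewrite divn_gt0 ?expn_gt0 // dvdn_leq // pfactor_dvdnn.
exists m; set S := geosum d.+1 m; set x := n %/ _.
have S_gt0 : 0 < S by apply: geosum_gt0.
have gcd_gt0 : 0 < gcdn n S by rewrite gcdn_gt0 n_gt0.
have x_gt0 : 0 < x by rewrite divn_gt0 // dvdn_leq // dvdn_gcdl.
have xn : x %| n by apply: dvdn_div; apply: dvdn_gcdl.
have -> : gcdn d x = gcdn g x by rewrite -gcdnA (gcdn_idPr xn).
apply: eqn_from_log => //; first by rewrite gcdn_gt0 g_gt0.
move=> l; have [l_pr|l_npr] := boolP (prime l); last first.
  by rewrite [LHS]lognE [RHS]lognE (negbTE l_npr).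
have vh : logn l h <= logn l g by apply: dvdn_leq_log.
have vg : logn l g <= logn l n by apply: dvdn_leq_log => //; apply: dvdn_gcdr.
rewrite logn_gcd // logn_div ?dvdn_gcdl // logn_gcd //.
have [ld|ld] := boolP (l %| d); last first.
  have : logn l g = 0.
    by rewrite logn_coprime // prime_coprime // dvdn_gcd (negbTE ld).
  by move=> g0; move: vh; rewrite g0 min0n leqn0 => /eqP.
have vnh : logn l (n %/ h) = logn l n - logn l h by rewrite logn_div.
(* In the first case lifting the exponent applies: [S] has the valuation of [n %/ h], so [x] has
   that of [h], which is at most that of [g]. *)
have [d4|/norP[]] := boolP ((l != 2) || (4 %| d)).
  have -> : logn l S = logn l n - logn l h.
    rewrite -vnh logn_geosum // => [|l2]; last by move: d4; rewrite l2.
    rewrite /m; case: ifP => // /andP[d4' _].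
    rewrite (negbTE d4') orbF in d4.
    by rewrite logn_div ?pfactor_dvdnn // lognX (@logn_prime l 2) // (negbTE d4) muln0 subn0.
  by move: vh vg; move: (logn l g) (logn l n) (logn l h); clear; lia.
rewrite negbK => /eqP l2 d4.
have vg1 : logn l g <= 1.
  rewrite -ltnS ltnNge -pfactor_dvdn // l2; apply: contra d4 => /dvdn_trans; apply.
  exact: dvdn_gcdl.
(* Now [l = 2] divides [g] at most once. If [h] is even, [m] and [S] are odd, so [x] keeps the
   2-part of [n] and both sides have valuation 1. If [h] is odd, [S] absorbs the whole 2-part of [n]
   and [x] is odd. *)
have [h2|h2] := boolP (2 %| h).
  have -> : logn l S = 0.
    rewrite logn_coprime ?prime_coprime // /dvdn geosum_mod // -/(l %| m).
    rewrite -[l]expn1 pfactor_dvdn // -ltnNge ltnS leqn0 l2 /m /bad d4 h2 /=.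
    by rewrite logn_div ?pfactor_dvdnn // pfactorK // subnn.
  have : 0 < logn l h by rewrite l2 -pfactor_dvdn.
  by move: vh vg vg1; move: (logn l g) (logn l n) (logn l h); clear; lia.
have : logn l m <= logn l S by apply: leq_logn_geosum.
have h0 : logn l h = 0 by rewrite l2 logn_coprime ?prime_coprime.
rewrite /m /bad (negbTE h2) andbF vnh h0.
by move: (logn l g) (logn l n) (logn l S); clear; lia.
Qed.

(** Write [i = i' * e] and [g = g' * e] with [e = gcdn g i], so that [i'] is prime to [g']. Take for
    [k] the part of [n] prime to [i']: each prime divisor of [n] divides exactly one of [i'] and
    [g' * k], hence not their sum [u]. *)
Lemma coprime_lift n g i : 0 < n -> 0 < i -> g %| n -> exists u k,
  [/\ 0 < u, coprime u n & u * gcdn g i = i + g * k].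
Proof.
move=> n_gt0 i_gt0 gn; set e := gcdn g i.
have e_gt0 : 0 < e by rewrite gcdn_gt0 i_gt0 orbT.
have /dvdnP[i' iE] := dvdn_gcdr g i; have /dvdnP[g' gE] := dvdn_gcdl g i.
rewrite -/e in iE gE.
have i'_gt0 : 0 < i' by lia.
have cop : coprime g' i'.
  by rewrite /coprime -(eqn_pmul2r e_gt0) mul1n muln_gcdl -gE -iE.
exists (i' + g' * n`_(\pi(i')^')), n`_(\pi(i')^'); split; first by lia.
  rewrite coprime_has_primes ?addn_gt0 ?i'_gt0 //; apply/hasPn => l.
  rewrite mem_primes => /and3P[l_pr _ ln]; rewrite mem_primes l_pr addn_gt0 i'_gt0 /=.
  have [li|li] := boolP (l %| i').
    rewrite dvdn_addr // Euclid_dvdM // negb_or; apply/andP; split.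
      by rewrite -prime_coprime // coprime_sym; apply: coprime_dvdr li cop.
    apply/negP => lk; have : l \in primes n`_(\pi(i')^') by rewrite mem_primes l_pr part_gt0.
    by rewrite primes_part mem_filter !inE /= mem_primes l_pr i'_gt0 li.
  rewrite dvdn_addl // dvdn_mull //.
  have : l \in primes n`_(\pi(i')^').
    by rewrite primes_part mem_filter !inE /= !mem_primes l_pr i'_gt0 n_gt0 ln (negbTE li).
  by rewrite mem_primes => /and3P[].
by rewrite mulnDl -iE mulnAC -gE.
Qed.

(** * Conjugation and iteration of monomial systems *)

Lemma dyn_equiv_iter (S T : Type) (f : S -> S) (g : T -> T) m :
  dyn_equiv f g -> dyn_equiv (iter m f) (iter m g).
Proof.
case=> s [s' [sK s'K sgs]]; exists s, s'; split=> // x /=.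
by elim: m => [|m IHm] /=; rewrite ?sK // -IHm -sgs /= s'K.
Qed.

Section MonomialSystems.
Local Open Scope ring_scope.

Lemma finField_prim_root (F : finFieldType) :
  exists z : F, (#|F| - 1).-primitive_root z.
Proof.
have F_gt1 : (0 < #|F| - 1)%N by rewrite subn_gt0 finNzRing_gt1.
pose s := enum [set x : F | x != 0].
have : has (#|F| - 1).-primitive_root s.
  apply: cyclic.has_prim_root => //; last 2 first.
  - exact: enum_uniq.
  - by rewrite -cardE cardsE (cardC1 (0 : F)) subn1.
  apply/allP => x; rewrite mem_enum inE => x_neq0.
  rewrite unity_rootE -(inj_eq (mulfI x_neq0)) -exprS mulr1 subn1 prednK.
    by rewrite expf_card.
  exact: ltnW (finNzRing_gt1 _).
by case/hasP => z _ zP; exists z.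
Qed.

Lemma iter_monomial (R : comRingType) (d m : nat) (a x : R) :
  iter m (fun y => a * y ^+ d) x = a ^+ geosum d m * x ^+ (d ^ m).
Proof.
elim: m => [|m IHm]; first by rewrite /geosum big_ord0 !mul1r.
by rewrite iterS IHm exprMn mulrA -!exprM -exprS geosumS add1n expnS ![(d * _)%N]mulnC.
Qed.

Section PrimitiveRoot.
Variables (F : finFieldType) (z : F) (n D : nat).
Hypotheses (zP : n.-primitive_root z) (cardF : n = (#|F| - 1)%N).

Definition monomial i : {ffun F -> F} := [ffun x => z ^+ i * x ^+ D.+1].

Let n_gt0 : (0 < n)%N := prim_order_gt0 zP.

Let z_neq0 : z != 0.
Proof. by rewrite (prim_root_eq0 zP) -lt0n. Qed.

Lemma prim_root_log x : x != 0 -> exists2 i, (0 < i)%N & x = z ^+ i.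
Proof.
move=> x_neq0; have xn : x ^+ n = 1.
  apply: (mulfI x_neq0); rewrite -exprS mulr1 cardF subn1 prednK ?expf_card //.
  exact: ltnW (finNzRing_gt1 _).
have [i ->] := prim_rootP zP xn.
(* Adding [n] makes the exponent positive, as [coprime_lift] requires. *)
by exists (i + n)%N; rewrite ?addn_gt0 ?n_gt0 ?orbT // exprD (prim_expr_order zP) mulr1.
Qed.

Lemma expr_coprime_inj u : (0 < u)%N -> coprime u n ->
  injective (fun x : F => x ^+ u).
Proof.
move=> u_gt0 cop; apply: can_inj (fun x => x ^+ (egcdn u n).1) _ => x.
have [->|x_neq0] := eqVneq x 0.
  (* The Bezout exponent inverting [u] must be nonzero, since [0 ^+ 0] is 1. *)
  rewrite expr0n gtn_eqF //= expr0n; case: egcdnP => // km kn; rewrite (eqP cop).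
  by case: km => //; rewrite mul0n addn1.
have [i _ ->] := prim_root_log x_neq0.
rewrite -!exprM; apply/eqP; rewrite (eq_prim_root_expr zP) (mulnC u).
case: egcdnP => // km kn E _; rewrite /= E (eqP cop) mulnDr muln1 mulnA.
by rewrite modnMDl.
Qed.

Lemma monomial_gcd_equiv i : (0 < i)%N ->
  dyn_equiv (monomial (gcdn (gcdn D n) i)) (monomial i).
Proof.
move=> i_gt0; set g := gcdn D n; set e := gcdn g i.
have [u [k [u_gt0 cop ueE]]] := coprime_lift n_gt0 i_gt0 (dvdn_gcdr D n).
rewrite -/g -/e in ueE.
(* Conjugating by [c * x ^+ u] with [c = z ^+ s] requires [u * e] to be [i + D * s] modulo [n]. As
   [u * e = i + g * k] and [g] is [- a * D] modulo [n], the choice [s = - a * k] works. *)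
have [a _ /dvdnP[b bE]] := Bezoutl D n_gt0; rewrite gcdnC -/g in bE.
pose c := z ^- (a * k).
have c_neq0 : c != 0 by rewrite invr_eq0 expf_neq0.
have sigma_inj : injective (fun x : F => c * x ^+ u).
  by move=> x y /(mulfI c_neq0) /(expr_coprime_inj u_gt0 cop).
have [tau sK tauK] := injF_bij sigma_inj.
exists (fun x => c * x ^+ u), tau; split=> // x /=.
apply: (canLR sK); rewrite !ffunE !exprMn -!exprM mulnC.
rewrite !mulrA; congr (_ * _).
have zE : z ^+ (i + a * k) = z ^+ (e * u) * (z ^+ (a * k)) ^+ D.+1.
  rewrite -exprM -exprD; apply/eqP; rewrite (eq_prim_root_expr zP).
  have -> : (e * u + a * k * D.+1 = k * b * n + (i + a * k))%N.
    rewrite -(mulnA k) -bE (mulnC e) ueE.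
    by move: (g) => g'; clear; lia.
  by rewrite modnMDl.
rewrite exprVn. apply: (mulIf (expf_neq0 D.+1 (expf_neq0 (a * k) z_neq0))).
rewrite mulfVK ?expf_neq0 //. rewrite -mulrA -zE exprD mulrCA mulVf ?mulr1 //.
exact: expf_neq0.
Qed.

Lemma iter_monomial_fixed i m t :
  (iter m (monomial i) (z ^+ t) == z ^+ t) =
  (n %| geosum D.+1 m * (i + D * t))%N.
Proof.
have -> : iter m (monomial i) (z ^+ t) = iter m (fun y => z ^+ i * y ^+ D.+1) (z ^+ t).
  by apply: eq_iter => y; rewrite ffunE.
rewrite iter_monomial -!exprM -exprD (eq_prim_root_expr zP) expn_geosum.
have -> : (i * geosum D.+1 m + t * (1 + D * geosum D.+1 m) =
           geosum D.+1 m * (i + D * t) + t)%N by lia.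
by rewrite -[in eqbRHS](add0n t) eqn_modDr mod0n -/(n %| _)%N.
Qed.

(** For the [m] realizing [h'], the iterate of [monomial h'] has a nonzero fixed point; carried over
    to [monomial h], it forces the divisibility. *)
Lemma monomial_equiv_dvdn h h' : (h' %| gcdn D n)%N ->
  dyn_equiv (monomial h) (monomial h') -> (h' %| h)%N.
Proof.
move=> h'g equ.
have [m mE] := geosum_realizes_divisor n_gt0 h'g; set S := geosum _ _ in mE.
have Sn_gt0 : (0 < gcdn n S)%N by rewrite gcdn_gt0 n_gt0.
set x := (n %/ _)%N in mE.
have xS : (x * gcdn n S = n)%N by rewrite divnK // dvdn_gcdl.
have x_gt0 : (0 < x)%N by rewrite divn_gt0 // dvdn_leq // dvdn_gcdl.
have [a _ xa] := Bezoutl D x_gt0; rewrite gcdnC mE in xa.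
have fix' : iter m (monomial h') (z ^+ a) = z ^+ a.
  apply/eqP; rewrite iter_monomial_fixed -/S -{1}xS mulnC.
  by rewrite dvdn_mul ?dvdn_gcdr // mulnC.
have iter0 i : iter m (monomial i) 0 = 0.
  by elim: m {mE S Sn_gt0 x xS x_gt0 xa fix'} => //= m ->; rewrite ffunE expr0n mulr0.
have [s [s' [sK s'K sgs]]] := dyn_equiv_iter m (dyn_equiv_sym equ).
have fixs y : iter m (monomial h') y = y -> iter m (monomial h) (s y) = s y.
  by move=> fy; apply: (can_inj s'K); have /= -> := sgs y; rewrite sK.
(* The conjugacy [s] need not fix 0, but 0 and [z ^+ a] are both fixed by the iterate and have
   distinct images, so one image is nonzero. *)
have [y y_neq0 fy] : exists2 y, y != 0 & iter m (monomial h) y = y.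
  have [s0|s_neq0] := eqVneq (s (z ^+ a)) 0; last by exists (s (z ^+ a)) => //; apply: fixs.
  exists (s 0); last exact: fixs.
  apply: contraNneq (expf_neq0 a z_neq0) => s00.
  by apply/eqP/(can_inj sK); rewrite s0 s00.
have [t _ yE] := prim_root_log y_neq0.
move/eqP: fy; rewrite yE iter_monomial_fixed -/S => nS.
(* Cancelling [gcdn n S] leaves [x], which is prime to the cofactor [S']. *)
have xh : (x %| h + D * t)%N.
  have [S' SE] := dvdnP (dvdn_gcdr n S).
  have cop : coprime x S'.
    by rewrite /coprime -(eqn_pmul2r Sn_gt0) mul1n muln_gcdl xS -SE.
  move: nS; rewrite -[X in (X %| _)%N]xS [X in (_ %| X * _)%N]SE mulnAC dvdn_pmul2r //.
  by rewrite Gauss_dvdr.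
have h'x : (h' %| x)%N by rewrite -mE dvdn_gcdr.
have h'D : (h' %| D)%N by rewrite -mE dvdn_gcdl.
by rewrite -(dvdn_addl h (dvdn_mulr t h'D)) (dvdn_trans h'x).
Qed.

End PrimitiveRoot.

End MonomialSystems.

(** * Counting the classes by the divisors of the gcd *)

Theorem theorem3p5 (p k q : nat) (p_prime : prime p) (k_gt0 : 0 < k)
    (q_def : q = p ^ k) (F : finFieldType) (cardF : #|F| = q)
    (d : nat) (d_ge1 : 1 <= d) :
  #|dyn_classes (monomial_systems F d)| = num_divisors (gcdn (d - 1) (q - 1)).
Proof.
case: d d_ge1 => // D _; rewrite subn1 /= -cardF.
have [z zP] := finField_prim_root F.
set n := (_ - 1)%N in zP *; have n_gt0 := prim_order_gt0 zP.
set g := gcdn D n; have g_gt0 : (0 < g)%N by rewrite gcdn_gt0 n_gt0 orbT.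
set X := monomial_systems F D.+1; pose M := monomial z D.
have MX i : M i \in X.
  apply/imsetP; exists (z ^+ i)%R => //.
  by rewrite inE expf_neq0 // (prim_root_eq0 zP) -lt0n.
(* This is the form in which [equivalence_partition] presents the class of [f]; the map sending [h]
   to [C (M h)] is shown to be a bijection from the divisors of [g] to the classes. *)
pose C f := [set f' in X | dyn_equivb f f'].
have CE i (f : {ffun F -> F}) : dyn_equiv (M i) f -> C (M i) = C f.
  move=> equ; apply/setP => f'; rewrite !inE; congr (_ && _).
  apply/asboolP/asboolP; first exact: dyn_equiv_trans (dyn_equiv_sym equ).
  exact: dyn_equiv_trans equ.
have uniq_s : uniq [seq C (M h) | h <- divisors g].
  rewrite map_inj_in_uniq ?divisors_uniq // => h h'.
  rewrite -!dvdn_divisors // => hg h'g.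
  move=> /setP/(_ (M h')); rewrite !inE MX /=.
  have -> : dyn_equivb (M h') (M h') by apply/asboolP/dyn_equiv_refl.
  move/asboolP => equ; apply/eqP; rewrite eqn_dvd.
  by rewrite (monomial_equiv_dvdn zP erefl hg (dyn_equiv_sym equ))
    (monomial_equiv_dvdn zP erefl h'g equ).
rewrite /num_divisors -(size_map (fun h => C (M h))) -(card_uniqP uniq_s).
apply: eq_card => P; apply/imsetP/mapP => [[f fX ->]|[h hg ->]]; last by exists (M h).
have /imsetP[a] := fX; rewrite inE => a_neq0 fE.
have [i i_gt0 aE] := prim_root_log zP erefl a_neq0.
have -> : f = M i by rewrite fE aE; apply/ffunP => x; rewrite !ffunE.
exists (gcdn g i); first by rewrite -dvdn_divisors // dvdn_gcdl.
by rewrite (CE _ (M i)) //; apply: monomial_gcd_equiv.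
Qed.
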